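(* (1) The type $\mathrm E$ of codes is a set. (2) The map $\mathfrak e:\mathrm B\to\mathrm E$ is an embedding. (3) For every Brouwer code $b$ there is an order equivalence $[\![b]\!]_{\Sigma_1}\simeq_o\Delta(\mathfrak e\,b)$. (4) For every Brouwer code $b$ there is an order equivalence $[\![b]\!]_{\Sigma^1}\simeq_o\mathrm K(\mathfrak e\,b)$.
   Context: Foundation: intensional Martin-Löf type theory as in the HoTT Book, with $\mathbf 0$, $\mathbf 1$ (point $\star$), $\mathbf 2$ (points $0,1$), $\mathbb N$, $+$, $\Pi$, $\Sigma$, $\mathsf W$-types, universes, univalence (hence function extensionality), propositional truncation, set quotients, and inductive-recursive definitions. No excluded middle is assumed. $f^{-1}(y):=\Sigma_x(f\,x=y)$; an embedding is a map all of whose fibers are propositions (types with at most one element). A set is a type whose identity types are propositions. Ordinals. An ordinal is a type with a proposition-valued, transitive, extensional (elements with the same predecessors are equal), well-founded relation $<$; the same symbol denotes an ordinal and its underlying type. $\alpha\simeq_o\beta$ means there is an order-preserving equivalence of underlying types with order-preserving inverse. $\mathbf 1$ is an ordinal with the empty order. A topped ordinal is an ordinal with a specified point $t$ such that $\neg(t<y)$ for all $y$; $\mathrm{Ord}^\top$ is their type. For a topped ordinal $\tau$ and $\upsilon:\tau\to\mathrm{Ord}^\top$, $\Sigma_\tau\upsilon$ is the topped ordinal $\Sigma_{x:\tau}\upsilon\,x$ with the lexicographic order: $(x,a)<(x',a')$ iff $x<x'$, or there is $r:x=x'$ such that the transport of $a$ along $r$ is below $a'$; its top is the pair of tops. The sum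 $\tau+\upsilon$ of topped ordinals is the lexicographic sum, over the two-point topped ordinal with underlying type $\mathbf 1+\mathbf 1$ and $\mathrm{inl}\,\star<\mathrm{inr}\,\star$, of the family with members $\tau,\upsilon$; its points are pairs $(\mathrm{inl}\,\star,x)$ or $(\mathrm{inr}\,\star,y)$. The topped ordinal $\omega+\mathbf 1$ is $\mathbb N+\mathbf 1$ with the usual order on $\mathbb N$ and the added point as top, above all $\mathrm{inl}\,n$. Conaturals: $\mathbb N_\infty:=\Sigma_{u:\mathbf 2^{\mathbb N}}\prod_i u_{i+1}\le u_i$; $\underline n$ is $n$ ones followed by zeros; $\infty$ is constantly $1$; $\iota:\mathbb N\hookrightarrow\mathbb N_\infty$, $\iota\,n=\underline n$. It is a topped ordinal with top $\infty$ under $u<v:\equiv\Sigma_{n:\mathbb N}(u=\underline n)\times(v_n=1)$. $\iota_1:\mathbb N+\mathbf 1\hookrightarrow\mathbb N_\infty$ sends $\mathrm{inl}\,n$ to $\underline n$ and the added point to $\infty$. Extension: for an embedding $j:X\hookrightarrow K$ and $\alpha:X\to\mathrm{Ord}^\top$, $(\alpha/j)\,k:=\prod_{(x,p):j^{-1}(k)}\alpha\,x$ with order $u<v:\equiv\Sigma_{p:j^{-1}(k)}\,u\,p<v\,p$ and top the function assigning tops. Evaluation at $(x,\mathrm{refl})$ is an order equivalence $(\alpha/j)(j\,x)\simeq_o\alpha\,x$. Brouwer codes: $\mathrm B$ is the inductive type with constructors $\mathsf Z:\mathrm B$, $\mathsf S:\mathrm B\to\mathrm B$, $\mathsf L:(\mathbb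 N\to\mathrm B)\to\mathrm B$. Interpretations $[\![-]\!]_{\Sigma_1},[\![-]\!]_{\Sigma^1}:\mathrm B\to\mathrm{Ord}^\top$: both send $\mathsf Z$ to $\mathbf 1$ and $\mathsf S\,b$ to (interpretation of $b$)$\,+\mathbf 1$, while $[\![\mathsf L\,b]\!]_{\Sigma_1}=\Sigma_{\omega+\mathbf 1}\big((n\mapsto[\![b\,n]\!]_{\Sigma_1})/\mathrm{inl}\big)$ with $\mathrm{inl}:\mathbb N\hookrightarrow\mathbb N+\mathbf 1$, and $[\![\mathsf L\,b]\!]_{\Sigma^1}=\Sigma_{\mathbb N_\infty}\big((n\mapsto[\![b\,n]\!]_{\Sigma^1})/\iota\big)$. Codes $\mathrm E$. $\mathrm E$ and $\Delta:\mathrm E\to\mathrm{Ord}^\top$ are defined simultaneously by induction-recursion. Constructors of $\mathrm E$: $\ulcorner\mathbf 1\urcorner$; $\ulcorner\omega+\mathbf 1\urcorner$; $\nu_0\,\ulcorner+\urcorner\,\nu_1$ and $\nu_0\,\ulcorner\times\urcorner\,\nu_1$ for $\nu_0,\nu_1:\mathrm E$; $\ulcorner\Sigma\urcorner\,\nu\,A$ for $\nu:\mathrm E$ and $A:\Delta\nu\to\mathrm E$. $\Delta\ulcorner\mathbf 1\urcorner=\mathbf 1$; $\Delta\ulcorner\omega+\mathbf 1\urcorner=\omega+\mathbf 1$; $\Delta(\nu_0\,\ulcorner+\urcorner\,\nu_1)=\Delta\nu_0+\Delta\nu_1$; $\Delta(\nu_0\,\ulcorner\times\urcorner\,\nu_1)=\Sigma_{\Delta\nu_0}(\lambda\_.\,\Delta\nu_1)$;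 $\Delta(\ulcorner\Sigma\urcorner\,\nu\,A)=\Sigma_{\Delta\nu}(\Delta\circ A)$. Simultaneously by induction on codes one defines $\mathrm K:\mathrm E\to\mathrm{Ord}^\top$ and $\iota_\nu:\Delta\nu\to\mathrm K\nu$ and proves that $\iota_\nu$ is an embedding: $\mathrm K\ulcorner\mathbf 1\urcorner=\mathbf 1$; $\mathrm K\ulcorner\omega+\mathbf 1\urcorner=\mathbb N_\infty$; $\mathrm K(\nu_0\,\ulcorner+\urcorner\,\nu_1)=\mathrm K\nu_0+\mathrm K\nu_1$; $\mathrm K(\nu_0\,\ulcorner\times\urcorner\,\nu_1)=\Sigma_{\mathrm K\nu_0}(\lambda\_.\,\mathrm K\nu_1)$; $\mathrm K(\ulcorner\Sigma\urcorner\,\nu\,A)=\Sigma_{\mathrm K\nu}\big((\mathrm K\circ A)/\iota_\nu\big)$; and $\iota_{\ulcorner\mathbf 1\urcorner}=\mathrm{id}$; $\iota_{\ulcorner\omega+\mathbf 1\urcorner}=\iota_1$; $\iota_{\nu_0\ulcorner+\urcorner\nu_1}(\mathrm{inl}\,\star,y)=(\mathrm{inl}\,\star,\iota_{\nu_0}y)$, $\iota_{\nu_0\ulcorner+\urcorner\nu_1}(\mathrm{inr}\,\star,y)=(\mathrm{inr}\,\star,\iota_{\nu_1}y)$; $\iota_{\nu_0\ulcorner\times\urcorner\nu_1}(x,y)=(\iota_{\nu_0}x,\iota_{\nu_1}y)$; $\iota_{\ulcorner\Sigma\urcorner\nu A}(x,z)=(\iota_\nu x,\varphi_x^{-1}(\iota_{A\,x}z))$,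 where $\varphi_x:((\mathrm K\circ A)/\iota_\nu)(\iota_\nu x)\simeq_o\mathrm K(A\,x)$ is evaluation at $(x,\mathrm{refl})$. The map $\mathfrak e:\mathrm B\to\mathrm E$ is defined by induction: $\mathfrak e\,\mathsf Z=\ulcorner\mathbf 1\urcorner$; $\mathfrak e(\mathsf S\,b)=\mathfrak e\,b\,\ulcorner+\urcorner\,\ulcorner\mathbf 1\urcorner$; $\mathfrak e(\mathsf L\,b)=\ulcorner\Sigma\urcorner\,\ulcorner\omega+\mathbf 1\urcorner\,A_b$, where $A_b:\mathbb N+\mathbf 1\to\mathrm E$ has $A_b(\mathrm{inl}\,n)=\mathfrak e(b\,n)$ and $A_b(\mathrm{inr}\,\star)=\ulcorner\mathbf 1\urcorner$. *)

(* Defs.v *)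
From Stdlib Require Import Arith Lia Bool FunctionalExtensionality Eqdep_dec.

Set Implicit Arguments.
Unset Strict Implicit.

(** Rocq's type theory, with [=] as identity type, plays the role of
    intensional Martin-Löf type theory.  Structure and order relations are
    [Type]-valued and untruncated.  Nothing below uses uniqueness of identity
    proofs or proof irrelevance; the only axiom used is function
    extensionality, which is what is needed of univalence. *)

Definition isProp (A : Type) : Type := forall x y : A, x = y.
Definition isSet (A : Type) : Type := forall x y : A, isProp (x = y).

Definition transport (A : Type) (P : A -> Type) (x y : A) (r : x = y)
  (a : P x) : P y :=
  match r in _ = z return P z with eq_refl => a end.

Definition fiber (X Y : Type) (f : X -> Y) (y : Y) : Type := {x : X & f x = y}.
Definition fiber_pt (X Y : Type) (f : X -> Y) (x : X) : fiber f (f x) :=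
  existT _ x eq_refl.
Definition isEmbedding (X Y : Type) (f : X -> Y) : Type :=
  forall y : Y, isProp (fiber f y).

Record isEquiv (X Y : Type) (f : X -> Y) : Type := {
  equiv_inv : Y -> X;
  equiv_eta : forall x, equiv_inv (f x) = x;
  equiv_eps : forall y, f (equiv_inv y) = y;
  equiv_adj : forall x, f_equal f (equiv_eta x) = equiv_eps (f x)
}.

(** [Acc] of the standard library only covers [Prop]-valued relations. *)
Inductive acc (X : Type) (lt : X -> X -> Type) (x : X) : Type :=
  acc_intro : (forall y, lt y x -> acc lt y) -> acc lt x.

Record is_ordinal (X : Type) (lt : X -> X -> Type) : Type := {
  io_prop : forall x y, isProp (lt x y);
  io_trans : forall x y z, lt x y -> lt y z -> lt x z;
  io_ext : forall x y, (forall z, lt z x -> lt z y) ->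
                       (forall z, lt z y -> lt z x) -> x = y;
  io_wf : forall x, acc lt x
}.

Record Ord : Type := {
  ord_car :> Type;
  olt : ord_car -> ord_car -> Type;
  ord_is : is_ordinal olt
}.

Record OrdT : Type := {
  ordt_ord :> Ord;
  top : ordt_ord;
  top_max : forall y, olt top y -> Empty_set
}.

Definition order_preserving (a b : Ord) (f : a -> b) : Type :=
  forall x y, olt x y -> olt (f x) (f y).

Record ord_equiv (a b : Ord) : Type := {
  oe_map : a -> b;
  oe_equiv : isEquiv oe_map;
  oe_op : order_preserving oe_map;
  oe_inv_op : order_preserving (equiv_inv oe_equiv)
}.
Notation "a ≃ₒ b" := (ord_equiv a b) (at level 70).

Lemma isSet_of_rel (A : Type) (R : A -> A -> Type)
  (Rp : forall x y, isProp (R x y)) (rho : forall x, R x x)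
  (f : forall x y, R x y -> x = y) : isSet A.
Proof.
  assert (K : forall x y (p : x = y),
             p = eq_trans (eq_sym (f x x (rho x)))
                   (f x y (transport (P := R x) p (rho x)))).
  { intros x y []; cbn. now destruct (f x x (rho x)). }
  intros x y p q.
  rewrite (K x y p), (K x y q). do 2 f_equal. apply Rp.
Qed.

Lemma isProp_isSet (A : Type) : isProp A -> isSet A.
Proof.
  intros h. apply (@isSet_of_rel A (fun _ _ => unit)).
  - now intros ? ? [] [].
  - intros; exact tt.
  - intros; apply h.
Qed.

Lemma isProp_pi (A : Type) (P : A -> Type) :
  (forall x, isProp (P x)) -> isProp (forall x, P x).
Proof. intros h f g. apply functional_extensionality_dep. intros; apply h. Qed.

Lemma isSet_ord (a : Ord) : isSet a.
Proof.
  destruct (ord_is a) as [hp _ he _].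
  apply (@isSet_of_rel a (fun x y => ((forall z, olt z x -> olt z y) *
                                      (forall z, olt z y -> olt z x))%type)).
  - intros x y [u v] [u' v'].
    f_equal; apply isProp_pi; intros z; apply isProp_pi; intros; apply hp.
  - intros x; split; auto.
  - intros x y [u v]; now apply he.
Qed.

Lemma acc_irrefl (X : Type) (lt : X -> X -> Type) (x : X) :
  acc lt x -> lt x x -> Empty_set.
Proof. induction 1 as [x _ IH]. intros h. exact (IH x h h). Qed.

Lemma transport_loop (A : Type) (P : A -> Type) (x : A) (hA : isSet A)
  (r : x = x) (a : P x) : transport (P := P) r a = a.
Proof. now rewrite (hA _ _ r eq_refl). Qed.

Lemma existT_inj (A : Type) (P : A -> Type) (hA : isSet A) (x : A) (a b : P x) :
  existT P x a = existT P x b -> a = b.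
Proof.
  intros e.
  assert (H : {r : x = x & transport (P := P) r a = b}).
  { change ({r : x = projT1 (existT P x b) &
              transport (P := P) r a = projT2 (existT P x b)}).
    destruct e. now exists eq_refl. }
  destruct H as [r <-]. symmetry. now apply transport_loop.
Qed.

Lemma isEmbedding_of_inj (X Y : Type) (f : X -> Y) :
  isSet Y -> (forall x x', f x = f x' -> x = x') -> isEmbedding f.
Proof.
  intros hY inj y [x p] [x' p'].
  assert (r : x = x') by (apply inj; now rewrite p, p').
  destruct r. now rewrite (hY _ _ p p').
Qed.

Lemma embedding_inj (X Y : Type) (f : X -> Y) :
  isEmbedding f -> forall x x', f x = f x' -> x = x'.
Proof.
  intros h x x' p.
  exact (f_equal (@projT1 _ _)
           (h (f x') (existT _ x p) (existT _ x' eq_refl))).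
Qed.

Definition one_lt (_ _ : unit) : Type := Empty_set.

Lemma one_is : is_ordinal one_lt.
Proof.
  split.
  - intros ? ? [].
  - intros ? ? ? [].
  - now intros [] [].
  - intros x; split; intros ? [].
Qed.

Definition oneT : OrdT :=
  @Build_OrdT (Build_Ord one_is) tt (fun _ h => h).

Definition two_lt (x y : unit + unit) : Type :=
  match x, y with
  | inl _, inr _ => unit
  | _, _ => Empty_set
  end.

Lemma two_is : is_ordinal two_lt.
Proof.
  split.
  - intros [[]|[]] [[]|[]] p q; now destruct p, q.
  - intros [[]|[]] [[]|[]] [[]|[]]; cbn; tauto.
  - intros [[]|[]] [[]|[]] h h'; trivial.
    + destruct (h' (inl tt) tt).
    + destruct (h (inl tt) tt).
  - assert (a0 : acc two_lt (inl tt)) by (split; intros [[]|[]] []).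
    intros [[]|[]]; trivial. split; intros [[]|[]] h; trivial. destruct h.
Qed.

Lemma two_top (y : unit + unit) : two_lt (inr tt) y -> Empty_set.
Proof. now destruct y. Qed.

Definition twoT : OrdT := @Build_OrdT (Build_Ord two_is) (inr tt) two_top.

Definition omega1_lt (x y : nat + unit) : Type :=
  match x, y with
  | inl m, inl n => m < n
  | inl _, inr _ => unit
  | inr _, _ => Empty_set
  end.

Lemma acc_lt_nat_map (X : Type) (lt : X -> X -> Type) (g : nat -> X) :
  (forall n y, lt y (g n) -> {m : nat & ((m < n) * (y = g m))%type}) ->
  forall n, acc lt (g n).
Proof.
  intros h n.
  assert (H : forall k m, m < k -> acc lt (g m)).
  { induction k as [|k IH]; [lia|].
    intros m hm. split. intros y hy.
    destruct (h m y hy) as [m' [h1 ->]]. apply IH. lia. }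
  apply (H (S n)). lia.
Qed.

Lemma omega1_is : is_ordinal omega1_lt.
Proof.
  split.
  - intros [m|[]] [n|[]] p q; cbn in *; try now destruct p, q.
    apply le_unique.
  - intros [m|[]] [n|[]] [k|[]]; cbn; try tauto; lia.
  - intros [m|[]] [n|[]] h h'; trivial.
    + f_equal. apply Nat.le_antisymm; apply Nat.nlt_ge; intros l.
      * apply (Nat.lt_irrefl n). exact (h (inl n) l).
      * apply (Nat.lt_irrefl m). exact (h' (inl m) l).
    + destruct (Nat.lt_irrefl m (h' (inl m) tt)).
    + destruct (Nat.lt_irrefl n (h (inl n) tt)).
  - assert (a : forall n, acc omega1_lt (inl n)).
    { apply (acc_lt_nat_map (g := fun n => inl n)).
      intros n [m|[]] l; cbn in l; [|destruct l]. now exists m. }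
    intros [n|[]]; trivial. split; intros [n|[]] l; trivial. destruct l.
Qed.

Definition omega1T : OrdT :=
  @Build_OrdT (Build_Ord omega1_is) (inr tt) (fun _ h => h).

Section Sum.
Variables (tau : OrdT) (ups : tau -> OrdT).

Definition sigma_lt (u v : {x : tau & ups x}) : Type :=
  (olt (projT1 u) (projT1 v) +
   {r : projT1 u = projT1 v &
      olt (transport (P := fun x => ups x) r (projT2 u)) (projT2 v)})%type.

Lemma sigma_is : is_ordinal sigma_lt.
Proof.
  pose proof (isSet_ord (a := tau)) as hset.
  pose proof (io_wf (ord_is tau)) as hwf.
  split.
  - intros [x a] [y b] [p|[p p']] [q|[q q']]; cbn in *.
    + f_equal. apply (io_prop (ord_is tau)).
    + destruct q. destruct (acc_irrefl (hwf x) p).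
    + destruct p. destruct (acc_irrefl (hwf x) q).
    + f_equal. destruct (hset _ _ p q).
      f_equal. apply (io_prop (ord_is (ups y))).
  - intros [x a] [y b] [z c] [p|[p p']] [q|[q q']]; cbn in *.
    + left; cbn. exact (io_trans (ord_is tau) p q).
    + destruct q. now left.
    + destruct p. now left.
    + destruct p, q. right; cbn. exists eq_refl.
      exact (io_trans (ord_is (ups x)) p' q').
  - intros [x a] [y b] h h'.
    assert (r : x = y).
    { apply (io_ext (ord_is tau)); intros z l.
      - destruct (h (existT _ z (top (ups z))) (inl l)) as [k|[k k']]; cbn in *.
        + exact k.
        + destruct k. destruct (top_max k').
      - destruct (h' (existT _ z (top (ups z))) (inl l)) as [k|[k k']]; cbn in *.
        + exact k.
        + destruct k. destruct (top_max k'). }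
    destruct r. f_equal.
    apply (io_ext (ord_is (ups x))); intros c l.
    + destruct (h (existT _ x c) (inr (existT _ eq_refl l))) as [k|[k k']];
        cbn in *.
      * destruct (acc_irrefl (hwf x) k).
      * now rewrite (transport_loop hset) in k'.
    + destruct (h' (existT _ x c) (inr (existT _ eq_refl l))) as [k|[k k']];
        cbn in *.
      * destruct (acc_irrefl (hwf x) k).
      * now rewrite (transport_loop hset) in k'.
  - intros [x a]. revert a. induction (hwf x) as [x _ IHx]. intros a.
    induction (io_wf (ord_is (ups x)) a) as [a _ IHa].
    split. intros [y b] [p|[p p']]; cbn in *.
    + now apply IHx.
    + destruct p. now apply IHa.
Qed.

Definition sigma_top : {x : tau & ups x} := existT _ (top tau) (top (ups (top tau))).

Lemma sigma_top_max v : sigma_lt sigma_top v -> Empty_set.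
Proof.
  destruct v as [y b]. intros [p|[p p']]; cbn in *.
  - exact (top_max p).
  - destruct p. exact (top_max p').
Qed.

Definition sigmaT : OrdT := @Build_OrdT (Build_Ord sigma_is) sigma_top sigma_top_max.
End Sum.

Definition two_family (t0 t1 : OrdT) (i : twoT) : OrdT :=
  match (i : unit + unit) with inl _ => t0 | inr _ => t1 end.

Definition plusT (t0 t1 : OrdT) : OrdT := sigmaT (two_family t0 t1).

Definition timesT (t0 t1 : OrdT) : OrdT := sigmaT (fun _ : t0 => t1).

Section Extension.
Variables (X K : Type) (j : X -> K) (hj : isEmbedding j) (alpha : X -> OrdT).

Definition ext_car (k : K) : Type := forall q : fiber j k, alpha (projT1 q).

Definition ext_lt (k : K) (u v : ext_car k) : Type :=
  {p : fiber j k & olt (u p) (v p)}.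

Lemma ext_is (k : K) : is_ordinal (@ext_lt k).
Proof.
  split.
  - intros u v [p l] [q l']. destruct (hj p q). f_equal.
    apply (io_prop (ord_is (alpha (projT1 p)))).
  - intros u v w [p l] [q l']. destruct (hj p q). exists p.
    exact (io_trans (ord_is (alpha (projT1 p))) l l').
  - assert (half : forall (u v : ext_car k),
               (forall w, ext_lt w u -> ext_lt w v) ->
               forall p a, olt a (u p) -> olt a (v p)).
    { intros u v h p a l.
      pose (w := fun q : fiber j k =>
                   transport (P := fun q => alpha (projT1 q)) (hj p q) a).
      assert (wp : w p = a).
      { exact (@transport_loop (fiber j k) (fun q => alpha (projT1 q)) p
                 (isProp_isSet (hj (y := k))) (hj p p) a). }
      destruct (h w) as [q k'].
      - exists p. now rewrite wp.
      - destruct (hj p q). now rewrite wp in k'. }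
    intros u v h h'. apply functional_extensionality_dep. intros p.
    apply (io_ext (ord_is (alpha (projT1 p)))); intros a; now apply half.
  - assert (H : forall p (a : alpha (projT1 p)), acc (@olt _) a ->
                forall u : ext_car k, u p = a -> acc (@ext_lt k) u).
    { intros p a ha. induction ha as [a _ IH]. intros u e.
      split. intros w [q l]. destruct (hj p q).
      rewrite e in l. exact (IH _ l w eq_refl). }
    intros u. split. intros w [p l].
    exact (H p _ (io_wf (ord_is (alpha (projT1 p))) (w p)) w eq_refl).
Qed.

Definition ext_top (k : K) : ext_car k := fun q => top (alpha (projT1 q)).

Lemma ext_top_max (k : K) (v : ext_car k) : ext_lt (ext_top (k := k)) v -> Empty_set.
Proof. intros [p l]. exact (top_max l). Qed.

Definition extT (k : K) : OrdT :=
  @Build_OrdT (Build_Ord (ext_is k)) (ext_top (k := k)) (@ext_top_max k).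

Definition ext_eval (x : X) : extT (j x) -> alpha x :=
  fun u => u (fiber_pt j x).

Definition ext_eval_inv (x : X) (a : alpha x) : extT (j x) :=
  fun q => transport (P := fun q => alpha (projT1 q))
             (hj (fiber_pt j x) q) a.

Lemma ext_eval_eps (x : X) (a : alpha x) : ext_eval (ext_eval_inv a) = a.
Proof.
  exact (@transport_loop (fiber j (j x)) (fun q => alpha (projT1 q)) (fiber_pt j x)
           (isProp_isSet (hj (y := j x))) (hj _ _) a).
Qed.

Lemma ext_eval_eta (x : X) (u : extT (j x)) : ext_eval_inv (ext_eval u) = u.
Proof.
  apply functional_extensionality_dep. intros q. unfold ext_eval, ext_eval_inv.
  now destruct (hj (fiber_pt j x) q).
Qed.

Lemma ext_eval_isEquiv (x : X) : isEquiv (ext_eval (x := x)).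
Proof.
  apply (Build_isEquiv (equiv_eta := @ext_eval_eta x) (equiv_eps := @ext_eval_eps x)).
  intros u. apply isSet_ord.
Defined.

Definition ext_eval_oe (x : X) : extT (j x) ≃ₒ alpha x.
Proof.
  apply (Build_ord_equiv (oe_equiv := ext_eval_isEquiv x)).
  - intros u v [p l]. exact (transport (P := fun q => olt (u q) (v q)) (hj p (fiber_pt j x)) l).
  - intros a b l. exists (fiber_pt j x).
    change (olt (ext_eval (ext_eval_inv a)) (ext_eval (ext_eval_inv b))).
    now rewrite !ext_eval_eps.
Defined.
End Extension.

Definition Ninf : Type := {u : nat -> bool & forall i, Bool.le (u (S i)) (u i)}.

Lemma under_dec (n i : nat) : Bool.le (Nat.ltb (S i) n) (Nat.ltb i n).
Proof.
  unfold Bool.le. destruct (Nat.ltb_spec (S i) n); trivial.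
  apply Nat.ltb_lt. lia.
Qed.

Definition under (n : nat) : Ninf := existT _ (fun i => Nat.ltb i n) (under_dec n).

Definition infty : Ninf := existT _ (fun _ => true) (fun _ => eq_refl).

Lemma Ninf_eq (u v : Ninf) : (forall i, projT1 u i = projT1 v i) -> u = v.
Proof.
  destruct u as [u hu], v as [v hv]; cbn. intros h.
  assert (r : u = v) by (apply functional_extensionality_dep; exact h).
  destruct r. f_equal. revert hu hv. apply isProp_pi. intros i.
  unfold Bool.le. destruct (u (S i)).
  - intros p q. apply UIP_dec, bool_dec.
  - now intros [] [].
Qed.

Lemma under_inj (m n : nat) : under m = under n -> m = n.
Proof.
  intros h.
  assert (H : forall i, Nat.ltb i m = Nat.ltb i n)
    by (intros i; exact (f_equal (fun w : Ninf => projT1 w i) h)).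
  pose proof (H m) as h1. pose proof (H n) as h2.
  rewrite Nat.ltb_irrefl in h1, h2.
  symmetry in h1. apply Nat.ltb_ge in h1. apply Nat.ltb_ge in h2. lia.
Qed.

Lemma infty_not_under (n : nat) : infty = under n -> Empty_set.
Proof.
  intros h. pose proof (f_equal (fun w : Ninf => projT1 w n) h) as e.
  change (true = Nat.ltb n n) in e. rewrite Nat.ltb_irrefl in e. discriminate.
Qed.

Lemma Ninf_down (u : Ninf) (m n : nat) :
  m <= n -> projT1 u n = true -> projT1 u m = true.
Proof.
  destruct u as [u hu]; cbn. induction 1 as [|n _ IH]; trivial.
  intros h. apply IH. specialize (hu n). unfold Bool.le in hu.
  now rewrite h in hu.
Qed.

Definition Ninf_lt (u v : Ninf) : Type :=
  {n : nat & ((u = under n) * (projT1 v n = true))%type}.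

Lemma isSet_Ninf : isSet Ninf.
Proof.
  apply (@isSet_of_rel Ninf (fun u v => forall i, projT1 u i = projT1 v i)).
  - intros u v. apply isProp_pi. intros i p q. apply UIP_dec, bool_dec.
  - trivial.
  - apply Ninf_eq.
Qed.

Lemma Ninf_is : is_ordinal Ninf_lt.
Proof.
  split.
  - intros u v [m [p p']] [n [q q']].
    assert (r : m = n) by (apply under_inj; now rewrite <- p, <- q).
    destruct r. do 2 f_equal.
    + apply isSet_Ninf.
    + apply UIP_dec, bool_dec.
  - intros u v w [m [p p']] [n [q q']]. exists m. split; trivial.
    rewrite q in p'. apply Nat.ltb_lt in p'.
    apply (Ninf_down (n := n)); [lia|trivial].
  - assert (half : forall u v, (forall z, Ninf_lt z u -> Ninf_lt z v) ->
               forall i, projT1 u i = true -> projT1 v i = true).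
    { intros u v h i e. destruct (h (under i)) as [n [p q]].
      - now exists i.
      - apply under_inj in p. now rewrite p. }
    intros u v h h'. apply Ninf_eq. intros i.
    pose proof (half _ _ h i) as k. pose proof (half _ _ h' i) as k'.
    destruct (projT1 u i), (projT1 v i); intuition congruence.
  - assert (a : forall n, acc Ninf_lt (under n)).
    { apply acc_lt_nat_map. intros n y [m [p q]]. exists m.
      split; trivial. now apply Nat.ltb_lt. }
    intros u. split. intros y [m [p _]]. rewrite p. apply a.
Qed.

Lemma Ninf_top_max (y : Ninf) : Ninf_lt infty y -> Empty_set.
Proof. intros [n [p _]]. exact (infty_not_under p). Qed.

Definition NinfT : OrdT := @Build_OrdT (Build_Ord Ninf_is) infty Ninf_top_max.

Definition iota (n : nat) : NinfT := under n.

Lemma iota_emb : isEmbedding iota.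
Proof. apply isEmbedding_of_inj; [apply isSet_Ninf|apply under_inj]. Qed.

Definition iota1 (x : omega1T) : NinfT :=
  match (x : nat + unit) with inl n => under n | inr _ => infty end.

Lemma iota1_emb : isEmbedding iota1.
Proof.
  apply isEmbedding_of_inj; [apply isSet_Ninf|].
  intros [m|[]] [n|[]] h; cbn in h; trivial.
  - f_equal. now apply under_inj.
  - symmetry in h. destruct (infty_not_under h).
  - destruct (infty_not_under h).
Qed.

Definition inlN (n : nat) : omega1T := inl n.

Lemma inlN_emb : isEmbedding inlN.
Proof.
  apply isEmbedding_of_inj; [apply isSet_ord|].
  intros m n h. exact (f_equal (fun z : nat + unit =>
    match z with inl k => k | inr _ => m end) h).
Qed.

Inductive B : Type :=
| BZ : B
| BS : B -> B
| BL : (nat -> B) -> B.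

(** The interpretation with subscript [Σ₁]. *)
Fixpoint brouwer_sub (b : B) : OrdT :=
  match b with
  | BZ => oneT
  | BS b => plusT (brouwer_sub b) oneT
  | BL b => sigmaT (extT inlN_emb (fun n => brouwer_sub (b n)))
  end.

(** The interpretation with superscript [Σ¹]. *)
Fixpoint brouwer_sup (b : B) : OrdT :=
  match b with
  | BZ => oneT
  | BS b => plusT (brouwer_sup b) oneT
  | BL b => sigmaT (extT iota_emb (fun n => brouwer_sup (b n)))
  end.

(** The inductive-recursive pair [(E, Delta)] is presented by the indexed
    family of codes with a prescribed value of [Delta]; the total space [E] of
    this family, with [Delta] its first projection, satisfies the formation,
    introduction, elimination ([E_elim]) and computation rules of the
    inductive-recursive definition, the latter up to conversion.  The price is
    that [E] lives one universe above the ordinals it denotes. *)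
Inductive E_at : OrdT -> Type :=
| at_one : E_at oneT
| at_omega1 : E_at omega1T
| at_plus : forall t0 t1, E_at t0 -> E_at t1 -> E_at (plusT t0 t1)
| at_times : forall t0 t1, E_at t0 -> E_at t1 -> E_at (timesT t0 t1)
| at_sigma : forall (t : OrdT) (a : t -> OrdT),
    E_at t -> (forall x, E_at (a x)) -> E_at (sigmaT a).

Set Primitive Projections.
Record E : Type := mkE { Delta : OrdT; E_code : E_at Delta }.
Unset Primitive Projections.

Definition c_one : E := mkE at_one.
Definition c_omega1 : E := mkE at_omega1.
Definition c_plus (nu0 nu1 : E) : E := mkE (at_plus (E_code nu0) (E_code nu1)).
Definition c_times (nu0 nu1 : E) : E := mkE (at_times (E_code nu0) (E_code nu1)).
Definition c_sigma (nu : E) (A : Delta nu -> E) : E :=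
  mkE (at_sigma (a := fun x => Delta (A x)) (E_code nu) (fun x => E_code (A x))).

Fact Delta_one : Delta c_one = oneT. Proof. reflexivity. Qed.
Fact Delta_omega1 : Delta c_omega1 = omega1T. Proof. reflexivity. Qed.
Fact Delta_plus nu0 nu1 : Delta (c_plus nu0 nu1) = plusT (Delta nu0) (Delta nu1).
Proof. reflexivity. Qed.
Fact Delta_times nu0 nu1 :
  Delta (c_times nu0 nu1) = sigmaT (fun _ : Delta nu0 => Delta nu1).
Proof. reflexivity. Qed.
Fact Delta_sigma nu (A : Delta nu -> E) :
  Delta (c_sigma A) = sigmaT (fun x => Delta (A x)).
Proof. reflexivity. Qed.

Section Elim.
Variables (P : E -> Type)
  (P_one : P c_one)
  (P_omega1 : P c_omega1)
  (P_plus : forall nu0 nu1, P nu0 -> P nu1 -> P (c_plus nu0 nu1))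
  (P_times : forall nu0 nu1, P nu0 -> P nu1 -> P (c_times nu0 nu1))
  (P_sigma : forall nu (A : Delta nu -> E),
      P nu -> (forall x, P (A x)) -> P (c_sigma A)).

Fixpoint E_at_elim (t : OrdT) (c : E_at t) : P (mkE c) :=
  match c in E_at t return P (mkE c) with
  | at_one => P_one
  | at_omega1 => P_omega1
  | at_plus c0 c1 => P_plus (E_at_elim c0) (E_at_elim c1)
  | at_times c0 c1 => P_times (E_at_elim c0) (E_at_elim c1)
  | @at_sigma t a c d =>
      @P_sigma (mkE c) (fun x => mkE (d x)) (E_at_elim c)
        (fun x => E_at_elim (d x))
  end.

Definition E_elim (nu : E) : P nu := E_at_elim (E_code nu).

Fact E_elim_one : E_elim c_one = P_one. Proof. reflexivity. Qed.
Fact E_elim_omega1 : E_elim c_omega1 = P_omega1. Proof. reflexivity. Qed.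
Fact E_elim_plus nu0 nu1 :
  E_elim (c_plus nu0 nu1) = P_plus (E_elim nu0) (E_elim nu1).
Proof. reflexivity. Qed.
Fact E_elim_times nu0 nu1 :
  E_elim (c_times nu0 nu1) = P_times (E_elim nu0) (E_elim nu1).
Proof. reflexivity. Qed.
Fact E_elim_sigma nu (A : Delta nu -> E) :
  E_elim (c_sigma A) = P_sigma (E_elim nu) (fun x => E_elim (A x)).
Proof. reflexivity. Qed.
End Elim.

Record completion (t : OrdT) : Type := {
  cK : OrdT;
  cmap : t -> cK;
  cemb : isEmbedding cmap
}.

Arguments cmap {t} c x.
Arguments cemb {t} c.

Definition comp_one : completion oneT.
Proof.
  apply (@Build_completion oneT oneT (fun x => x)).
  intros y [x p] [x' p']. now destruct p, p'.
Defined.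

Definition comp_omega1 : completion omega1T := Build_completion iota1_emb.

Section CompPlus.
Variables (t0 t1 : OrdT) (c0 : completion t0) (c1 : completion t1).

Definition plus_map (z : plusT t0 t1) : plusT (cK c0) (cK c1) :=
  match z with
  | existT _ i y =>
      match i as i return
        two_family t0 t1 i -> plusT (cK c0) (cK c1) with
      | inl s => fun y => existT _ (inl s : twoT) (cmap c0 y)
      | inr s => fun y => existT _ (inr s : twoT) (cmap c1 y)
      end y
  end.

Lemma plus_map_emb : isEmbedding plus_map.
Proof.
  apply isEmbedding_of_inj; [apply isSet_ord|].
  pose proof (isSet_ord (a := twoT)) as h2.
  intros [[[]|[]] y] [[[]|[]] y'] e; cbn in e.
  - apply (existT_inj h2) in e. apply (embedding_inj (cemb c0)) in e. now rewrite e.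
  - discriminate (projT1_eq e).
  - discriminate (projT1_eq e).
  - apply (existT_inj h2) in e. apply (embedding_inj (cemb c1)) in e. now rewrite e.
Qed.

Definition comp_plus : completion (plusT t0 t1) := Build_completion plus_map_emb.
End CompPlus.

Section CompTimes.
Variables (t0 t1 : OrdT) (c0 : completion t0) (c1 : completion t1).

Definition times_map (z : timesT t0 t1) : timesT (cK c0) (cK c1) :=
  existT _ (cmap c0 (projT1 z)) (cmap c1 (projT2 z)).

Lemma times_map_emb : isEmbedding times_map.
Proof.
  apply isEmbedding_of_inj; [apply isSet_ord|].
  intros [x y] [x' y'] e.
  assert (e1 : x = x')
    by (apply (embedding_inj (cemb c0)); exact (f_equal (fun z => projT1 z) e)).
  destruct e1. apply (existT_inj (isSet_ord (a := cK c0))) in e.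
  apply (embedding_inj (cemb c1)) in e. exact (f_equal (existT _ x) e).
Qed.

Definition comp_times : completion (timesT t0 t1) := Build_completion times_map_emb.
End CompTimes.

Section CompSigma.
Variables (t : OrdT) (a : t -> OrdT) (c : completion t)
  (d : forall x, completion (a x)).

Definition sigma_map (z : sigmaT a) : sigmaT (extT (cemb c) (fun x => cK (d x))) :=
  let x := projT1 z in
  existT _ (cmap c x)
    (equiv_inv (oe_equiv (ext_eval_oe (cemb c) (fun x => cK (d x)) x))
       (cmap (d x) (projT2 z))).

Lemma sigma_map_emb : isEmbedding sigma_map.
Proof.
  apply isEmbedding_of_inj; [apply isSet_ord|].
  intros [x y] [x' y'] e.
  assert (e1 : x = x')
    by (apply (embedding_inj (cemb c)); exact (f_equal (fun z => projT1 z) e)).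
  destruct e1. f_equal. apply (embedding_inj (cemb (d x))).
  apply (existT_inj (isSet_ord (a := cK c))) in e.
  pose (g := oe_equiv (ext_eval_oe (cemb c) (fun x => cK (d x)) x)).
  exact (eq_trans (eq_sym (equiv_eps g _))
           (eq_trans (f_equal _ e) (equiv_eps g _))).
Qed.

Definition comp_sigma : completion (sigmaT a) := Build_completion sigma_map_emb.
End CompSigma.

Definition comp (nu : E) : completion (Delta nu) :=
  E_elim (P := fun nu => completion (Delta nu)) comp_one comp_omega1
    (fun _ _ c0 c1 => comp_plus c0 c1)
    (fun _ _ c0 c1 => comp_times c0 c1)
    (fun _ _ c d => comp_sigma c d) nu.

Definition K (nu : E) : OrdT := cK (comp nu).
Definition iotaE (nu : E) : Delta nu -> K nu := cmap (comp nu).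
Definition iotaE_emb (nu : E) : isEmbedding (iotaE (nu := nu)) := cemb (comp nu).

Fact K_one : K c_one = oneT. Proof. reflexivity. Qed.
Fact K_omega1 : K c_omega1 = NinfT. Proof. reflexivity. Qed.
Fact K_plus nu0 nu1 : K (c_plus nu0 nu1) = plusT (K nu0) (K nu1).
Proof. reflexivity. Qed.
Fact K_times nu0 nu1 : K (c_times nu0 nu1) = sigmaT (fun _ : K nu0 => K nu1).
Proof. reflexivity. Qed.
Fact K_sigma nu (A : Delta nu -> E) :
  K (c_sigma A) = sigmaT (extT (iotaE_emb (nu := nu)) (fun x => K (A x))).
Proof. reflexivity. Qed.

Fixpoint encode (b : B) : E :=
  match b with
  | BZ => c_one
  | BS b => c_plus (encode b) c_one
  | BL b =>
      c_sigma (nu := c_omega1) (fun x : nat + unit =>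
        match x with
        | inl n => encode (b n)
        | inr _ => c_one
        end)
  end.

(* Main.v *)
From Stdlib Require Import FunctionalExtensionality.
Require Import Defs.

Set Implicit Arguments.
Unset Strict Implicit.

(** Two ideas carry the proof.

    _Equality of codes is structural._  By [same_code_eq] and [eq_same_code],
    two codes are equal when they have the same constructor and equal
    arguments, where for a sum the second arguments are compared along the
    equality of the first ones.  The value of [Delta] does not determine a code
    ([c_times] and a constant [c_sigma] have the same value), so equality has to
    be read off the code itself.  The structural description of [nu = nu']
    mentions only equalities that start at immediate subcodes of [nu], so by
    induction on [nu] it is a proposition, and [isSet_E] follows.  The same
    description gives injectivity of the constructors, hence of [encode], and an
    injection into a set is an embedding.

    _Extending along a larger domain by singletons changes nothing._  A Brouwer
    limit extends a sequence of ordinals from the naturals, while its code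
    extends the same sequence together with a one-point ordinal at infinity.  A
    function on a fiber gains no information from a component in a one-point
    ordinal, and a strict inequality between two such functions cannot be
    witnessed there.  So the two extensions agree at every point of the base
    ([ext_sum_singletons]), without deciding which points lie in the image of
    the naturals.  Taking the embedding of the enlarged domain to be [iota1]
    gives the statement about [K]; taking it to be the identity gives the
    statement about [Delta], because extension along the identity is
    evaluation.  The remaining work is that lexicographic sums respect pointwise
    order equivalence ([sigma_cong]). *)

(** * Equality of codes *)

Lemma isProp_sigma (A : Type) (P : A -> Type) :
  isProp A -> (forall x, isProp (P x)) -> isProp {x : A & P x}.
Proof. intros hA hP [x a] [y b]. destruct (hA x y). f_equal. apply hP. Qed.

Lemma isProp_prod (A C : Type) : isProp A -> isProp C -> isProp (A * C).
Proof. intros hA hC [a c] [a' c']. f_equal; auto. Qed.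

(** The form of [isSet_of_rel] with one end point fixed.  Fixing it is what lets
    the induction on codes go through: the hypothesis on a subcode concerns
    equalities from that subcode to an arbitrary code. *)
Lemma isProp_eq_of_pred (A : Type) (x : A) (R : A -> Type) :
  (forall y, isProp (R y)) -> R x -> (forall y, R y -> x = y) ->
  forall y, isProp (x = y).
Proof.
  intros hR rho f.
  assert (retract : forall y (p : x = y),
             p = eq_trans (eq_sym (f x rho)) (f y (transport (P := R) p rho))).
  { intros y []; cbn. now destruct (f x rho). }
  intros y p q. rewrite (retract y p), (retract y q). do 2 f_equal. apply hR.
Qed.

Lemma c_sigma_eq (nu nu' : E) (p : nu = nu')
  (A : Delta nu -> E) (A' : Delta nu' -> E) :
  (forall x, A x = A' (transport (P := fun nu => Delta nu) p x)) ->
  c_sigma A = c_sigma A'.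
Proof.
  destruct p; cbn. intros h.
  now destruct (functional_extensionality _ _ h).
Qed.

(** The arguments are compared by [=] rather than by a recursive call: a
    recursive definition would have to produce the transport in the last clause
    simultaneously with the relation. *)
Definition same_code (nu nu' : E) : Type :=
  match E_code nu, E_code nu' with
  | at_one, at_one => unit
  | at_omega1, at_omega1 => unit
  | at_plus c0 c1, at_plus c0' c1' =>
      (mkE c0 = mkE c0') * (mkE c1 = mkE c1')
  | at_times c0 c1, at_times c0' c1' =>
      (mkE c0 = mkE c0') * (mkE c1 = mkE c1')
  | at_sigma c d, at_sigma c' d' =>
      {p : mkE c = mkE c' &
         forall x, mkE (d x) = mkE (d' (transport (P := fun nu => Delta nu) p x))}
  | _, _ => Empty_set
  end.

Lemma same_code_refl (nu : E) : same_code nu nu.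
Proof.
  destruct nu as [t c]. destruct c; cbn; try exact tt; try now split.
  now exists eq_refl.
Qed.

Lemma eq_same_code (nu nu' : E) : nu = nu' -> same_code nu nu'.
Proof. intros []. apply same_code_refl. Qed.

Lemma same_code_eq (nu nu' : E) : same_code nu nu' -> nu = nu'.
Proof.
  destruct nu as [t c], nu' as [t' c'].
  destruct c as [ | | | |t a c d], c' as [ | | | |t' a' c' d']; cbn; intros h;
    try reflexivity; try now destruct h.
  - exact (f_equal2 c_plus (fst h) (snd h)).
  - exact (f_equal2 c_times (fst h) (snd h)).
  - destruct h as [p h].
    exact (c_sigma_eq (p := p) (A := fun x => mkE (d x))
             (A' := fun x => mkE (d' x)) h).
Qed.

Lemma isProp_eq_of_same_code (nu : E) :
  (forall nu', isProp (same_code nu nu')) -> forall nu', isProp (nu = nu').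
Proof.
  intros h. apply (isProp_eq_of_pred h (same_code_refl nu)).
  apply same_code_eq.
Qed.

Lemma isSet_E : isSet E.
Proof.
  intros nu.
  induction nu as [ | |nu0 nu1 IH0 IH1|nu0 nu1 IH0 IH1|nu A IH IHA] using E_elim;
    apply isProp_eq_of_same_code; intros [t c]; destruct c; cbn;
    try (now intros []); try (now intros [] []).
  - apply isProp_prod; [apply IH0|apply IH1].
  - apply isProp_prod; [apply IH0|apply IH1].
  - apply isProp_sigma; [apply IH|]. intros p. apply isProp_pi. intros x. apply IHA.
Qed.

(** * Brouwer codes embed into codes *)

Lemma encode_inj (b b' : B) : encode b = encode b' -> b = b'.
Proof.
  revert b'.
  induction b as [|b IH|b IH]; intros [|b'|b'] e;
    apply eq_same_code in e; cbn in e; try now destruct e.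
  - f_equal. exact (IH _ (fst e)).
  - f_equal. apply functional_extensionality. intros n. apply IH.
    destruct e as [p h].
    (* [p] is a loop at the code of [omega + 1], trivial because codes form a set. *)
    destruct (isSet_E (x := c_omega1) eq_refl p). exact (h (inl n)).
Qed.

(** * Order equivalences of sums and extensions *)

(** Ordinals are sets, so the coherence in [isEquiv] is automatic. *)
Lemma ord_equiv_of_inverses (a b : Ord) (f : a -> b) (g : b -> a) :
  order_preserving f -> order_preserving g ->
  (forall x, g (f x) = x) -> (forall y, f (g y) = y) -> a ≃ₒ b.
Proof.
  intros hf hg gf fg.
  pose (e := Build_isEquiv (equiv_eta := gf) (equiv_eps := fg)
               (fun x => isSet_ord (a := b) _ _)).
  exact (Build_ord_equiv (oe_equiv := e) hf hg).
Qed.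

Definition oe_back (a b : Ord) (e : a ≃ₒ b) : b -> a := equiv_inv (oe_equiv e).

Lemma oe_back_map (a b : Ord) (e : a ≃ₒ b) (x : a) : oe_back e (oe_map e x) = x.
Proof. apply equiv_eta. Qed.

Lemma oe_map_back (a b : Ord) (e : a ≃ₒ b) (y : b) : oe_map e (oe_back e y) = y.
Proof. apply equiv_eps. Qed.

Lemma ord_equiv_refl (a : Ord) : a ≃ₒ a.
Proof. now apply (@ord_equiv_of_inverses a a (fun x => x) (fun x => x)). Qed.

Lemma ord_equiv_trans (a b c : Ord) : a ≃ₒ b -> b ≃ₒ c -> a ≃ₒ c.
Proof.
  intros e e'.
  apply (@ord_equiv_of_inverses a c (fun x => oe_map e' (oe_map e x))
           (fun z => oe_back e (oe_back e' z))).
  - intros x y l. now do 2 apply oe_op.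
  - intros x y l. now do 2 apply oe_inv_op.
  - intros x. now rewrite !oe_back_map.
  - intros z. now rewrite !oe_map_back.
Qed.

Lemma sigma_fiberwise_order_preserving (tau : OrdT) (ups ups' : tau -> OrdT)
  (f : forall x, ups x -> ups' x) (hf : forall x, order_preserving (@f x)) :
  order_preserving (a := sigmaT ups) (b := sigmaT ups')
    (fun z => existT _ (projT1 z) (f (projT1 z) (projT2 z))).
Proof.
  intros [x a] [y b] [l|[r l]]; cbn in *.
  - now left.
  - destruct r. right; cbn. exists eq_refl. now apply hf.
Qed.

Lemma sigma_cong (tau : OrdT) (ups ups' : tau -> OrdT) :
  (forall x, ups x ≃ₒ ups' x) -> sigmaT ups ≃ₒ sigmaT ups'.
Proof.
  intros e.
  apply (ord_equiv_of_inverses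
           (sigma_fiberwise_order_preserving (fun x => @oe_op _ _ (e x)))
           (sigma_fiberwise_order_preserving (fun x => @oe_inv_op _ _ (e x)))).
  - intros [x a]; cbn. f_equal. apply equiv_eta.
  - intros [x a]; cbn. f_equal. apply equiv_eps.
Qed.

Lemma plus_cong (t0 t1 t0' t1' : OrdT) :
  t0 ≃ₒ t0' -> t1 ≃ₒ t1' -> plusT t0 t1 ≃ₒ plusT t0' t1'.
Proof. intros e0 e1. apply sigma_cong. intros [[]|[]]; assumption. Qed.

(** The components over [Y] carry one value each and no strict inequality, so
    they can be filled in or dropped.  Only membership in [X] or [Y] is decided,
    never whether [k] is in the image of [j]. *)
Lemma ext_sum_singletons (X Y K : Type) (j : X + Y -> K) (hj : isEmbedding j)
  (hjX : isEmbedding (fun x => j (inl x)))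
  (alpha : X -> OrdT) (beta : X + Y -> OrdT) :
  (forall x, alpha x ≃ₒ beta (inl x)) -> (forall y, isProp (beta (inr y))) ->
  forall k, extT hjX alpha k ≃ₒ extT hj beta k.
Proof.
  intros e hY k.
  pose (f := fun (u : extT hjX alpha k) (q : fiber j k) =>
    match q return beta (projT1 q) with
    | existT _ (inl x) p => oe_map (e x) (u (existT _ x p))
    | existT _ (inr y) _ => top (beta (inr y))
    end).
  pose (g := fun (v : extT hj beta k) (q : fiber (fun x => j (inl x)) k) =>
    oe_back (e (projT1 q)) (v (existT _ (inl (projT1 q)) (projT2 q)))).
  apply (@ord_equiv_of_inverses (extT hjX alpha k) (extT hj beta k) f g).
  - intros u v [[x p] l]. exists (existT _ (inl x) p). cbn. now apply oe_op.
  - intros u v [[[x|y] p] l].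
    + exists (existT _ x p). exact (@oe_inv_op _ _ (e x) _ _ l).
    + cbn in l. rewrite (hY y (u (existT _ (inr y) p)) (v (existT _ (inr y) p))) in l.
      destruct (acc_irrefl (io_wf (ord_is (beta (inr y))) _) l).
  - intros u. apply functional_extensionality_dep. intros [x p].
    apply oe_back_map.
  - intros v. apply functional_extensionality_dep. intros [[x|y] p].
    + apply oe_map_back.
    + apply hY.
Qed.

(** * The two interpretations of Brouwer codes *)

Lemma id_emb (X : Type) : isEmbedding (fun x : X => x).
Proof. intros y [x p] [x' p']. now destruct p, p'. Qed.

Lemma isProp_unit : isProp unit.
Proof. now intros [] []. Qed.

Definition limit_codes (b : nat -> B) (x : nat + unit) : E :=
  match x with inl n => encode (b n) | inr _ => c_one end.

Lemma brouwer_sub_encode (b : B) : brouwer_sub b ≃ₒ Delta (encode b).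
Proof.
  induction b as [|b IH|b IH]; cbn [brouwer_sub encode].
  - apply ord_equiv_refl.
  - exact (plus_cong IH (ord_equiv_refl oneT)).
  - apply sigma_cong. intros x.
    refine (ord_equiv_trans _ (ext_eval_oe (@id_emb _)
                                  (fun x => Delta (limit_codes b x)) x)).
    exact (ext_sum_singletons (j := fun x => x)
             (beta := fun x => Delta (limit_codes b x)) (@id_emb _) inlN_emb IH
             (fun _ => isProp_unit) x).
Qed.

Lemma brouwer_sup_encode (b : B) : brouwer_sup b ≃ₒ K (encode b).
Proof.
  induction b as [|b IH|b IH]; cbn [brouwer_sup encode].
  - apply ord_equiv_refl.
  - exact (plus_cong IH (ord_equiv_refl oneT)).
  - apply sigma_cong. intros k.
    exact (ext_sum_singletons (j := iota1) (beta := fun x => K (limit_codes b x))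
             iota1_emb iota_emb IH (fun _ => isProp_unit) k).
Qed.

Theorem theorem7p11 :
  (isSet E
   * isEmbedding encode
   * (forall b : B, brouwer_sub b ≃ₒ Delta (encode b))
   * (forall b : B, brouwer_sup b ≃ₒ K (encode b)))%type.
Proof.
  exact (isSet_E, isEmbedding_of_inj isSet_E encode_inj,
         brouwer_sub_encode, brouwer_sup_encode).
Qed.
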